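(* Let $K$ be a compact Hausdorff space and let $X\subseteq\mathcal C(K)$ be an infinite-dimensional uniform algebra, i.e. an infinite-dimensional closed subalgebra of $\mathcal C(K)$ which separates the points of $K$ and contains the constant functions. Then $X$ has the sequential strong diameter two property.
   Context: All Banach spaces are considered as real Banach spaces; $S_X$ denotes the unit sphere of $X$. $\mathcal C(K)$ is the Banach space of continuous functions on $K$ with the supremum norm. A Banach space $X$ has the sequential strong diameter two property (sequential SD2P) if, for every $m\in\mathbb N$ and every $x_1,\ldots,x_m\in S_X$, there are sequences $\{y_n^i\}_n$ ($1\le i\le m$) and $\{z_n\}_n$ in $S_X$ such that: for every $i$, the sequence $\{x_i-y_n^i\}_n$ is either norm-null or equivalent to the $c_0$ basis; $\{z_n\}_n$ is equivalent to the $c_0$ basis; and $\Vert y_n^i\pm z_n\Vert\to 1$ as $n\to\infty$ for every $i\in\{1,\ldots,m\}$. Here a sequence $\{u_n\}$ is equivalent to the $c_0$ basis if there are constants $0<a\le b$ such that $a\max_{j\le p}|\lambda_j|\le\Vert\sum_{j=1}^p\lambda_ju_j\Vert\le b\max_{j\le p}|\lambda_j|$ for all $p\in\mathbb N$ and $\lambda_1,\ldots,\lambda_p\in\mathbb R$. *)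

(* Defs.v *)
From HB Require Import structures.
From mathcomp Require Import all_boot all_order all_algebra.
From mathcomp Require Import complex.
From mathcomp Require Import mathcomp_extra boolp classical_sets functions reals.
From mathcomp Require Import topology normedtype sequences.

Set Implicit Arguments.
Unset Strict Implicit.
Unset Printing Implicit Defensive.

Import Order.TTheory GRing.Theory Num.Theory.
Import numFieldNormedType.Exports.

Local Open Scope classical_set_scope.
Local Open Scope ring_scope.

(* [Rcomplex R] is the library's copy of [R[i]] seen as a real vector space
   with the real-valued modulus as norm; only the topology is missing. *)
Section Rcomplex_normedModType.
Variable R : realType.

Lemma Rcomplex_normrZ (l : R) (x : Rcomplex R) : `|l *: x| = `|l| * `|x|.
Proof.
case: x => a b; change (Num.sqrt ((l * a) ^+ 2 + (l * b) ^+ 2) =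
  `|l| * Num.sqrt (a ^+ 2 + b ^+ 2)).
by rewrite !exprMn -mulrDr sqrtrM ?sqr_ge0// sqrtr_sqr.
Qed.

HB.instance Definition _ :=
  PseudoMetric.copy (Rcomplex R) (pseudoMetric_normed (Rcomplex R)).
HB.instance Definition _ := isPointed.Build (Rcomplex R) 0.
HB.instance Definition _ := NormedZmod_PseudoMetric_eq.Build R (Rcomplex R) erefl.
HB.instance Definition _ :=
  PseudoMetricNormedZmod_Lmodule_isNormedModule.Build R (Rcomplex R)
    Rcomplex_normrZ.

End Rcomplex_normedModType.

(* The space of continuous functions K -> V with the supremum norm. The proof
   that K is compact is part of the type: it is what makes the norm finite. *)
Definition contfun (K : topologicalType) (hK : compact [set: K])
  (R : realType) (V : normedModType R) : Type := continuousType K V.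

Section contfun_normedModType.
Variables (K : topologicalType) (hK : compact [set: K]).
Variables (R : realType) (V : normedModType R).
Local Notation C := (contfun hK V).


Lemma contfun_continuous (f : C) : continuous f.
Proof. exact: cts_fun. Qed.

Definition mk_contfun (f : K -> V) (cf : continuous f) : C :=
  mkcts cf : continuousType K V.

Lemma contfunP (f g : C) : f =1 g -> f = g.
Proof. by move=> fg; apply/continuousEP. Qed.

HB.instance Definition _ := Choice.copy C (continuousType K V).

Definition contfun_cst (v : V) : C := mk_contfun (@cst_continuous K V v).

Lemma contfun_opp_subproof (f : C) : continuous (fun t => - f t).
Proof. by move=> t; apply: cvgN; exact: contfun_continuous. Qed.

Lemma contfun_add_subproof (f g : C) : continuous (fun t => f t + g t).
Proof. by move=> t; apply: cvgD; exact: contfun_continuous. Qed.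

Lemma contfun_scale_subproof (l : R) (f : C) : continuous (fun t => l *: f t).
Proof. by move=> t; apply: cvgZl_tmp; exact: contfun_continuous. Qed.

Definition contfun_opp f := mk_contfun (@contfun_opp_subproof f).
Definition contfun_add f g := mk_contfun (@contfun_add_subproof f g).
Definition contfun_scale l f := mk_contfun (@contfun_scale_subproof l f).

Lemma contfun_addA : associative contfun_add.
Proof. by move=> f g h; apply: contfunP => t; exact: addrA. Qed.

Lemma contfun_addC : commutative contfun_add.
Proof. by move=> f g; apply: contfunP => t; exact: addrC. Qed.

Lemma contfun_add0 : left_id (contfun_cst 0) contfun_add.
Proof. by move=> f; apply: contfunP => t; exact: add0r. Qed.

Lemma contfun_addN : left_inverse (contfun_cst 0) contfun_opp contfun_add.
Proof. by move=> f; apply: contfunP => t; exact: addNr. Qed.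

HB.instance Definition _ := GRing.isZmodule.Build C
  contfun_addA contfun_addC contfun_add0 contfun_addN.

Lemma contfun_scaleA (a b : R) (f : C) :
  contfun_scale a (contfun_scale b f) = contfun_scale (a * b) f.
Proof. by apply: contfunP => t; exact: scalerA. Qed.

Lemma contfun_scale1 : left_id 1 contfun_scale.
Proof. by move=> f; apply: contfunP => t; exact: scale1r. Qed.

Lemma contfun_scaleDr : right_distributive contfun_scale +%R.
Proof. by move=> a f g; apply: contfunP => t; exact: scalerDr. Qed.

Lemma contfun_scaleDl (f : C) :
  {morph contfun_scale^~ f : a b / a + b}.
Proof. by move=> a b; apply: contfunP => t; exact: scalerDl. Qed.

HB.instance Definition _ := GRing.Zmodule_isLmodule.Build R C
  contfun_scaleA contfun_scale1 contfun_scaleDr contfun_scaleDl.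

Lemma contfunD (f g : C) t : (f + g) t = f t + g t. Proof. by []. Qed.
Lemma contfunN (f : C) t : (- f) t = - f t. Proof. by []. Qed.
Lemma contfunZ (l : R) (f : C) t : (l *: f) t = l *: f t. Proof. by []. Qed.
Lemma contfun0 t : (0 : C) t = 0. Proof. by []. Qed.

(* [sup set0 = 0], so an empty K gives the zero space. *)
Definition supnorm (f : C) : R := sup (range (fun t => `|f t|)).

Lemma supnorm_has_ubound (f : C) : has_ubound (range (fun t => `|f t|)).
Proof.
have /compact_bounded [M [_ HM]] : compact (range (fun t => `|f t|)).
  apply: continuous_compact => //; apply: continuous_subspaceT => t.
  by apply: cvg_norm; exact: contfun_continuous.
exists (M + 1) => _ [t _ <-].
have MM1 : M < M + 1 by rewrite ltrDl.
have := HM _ MM1 `|f t|; rewrite /= normr_id; apply; by exists t.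
Qed.

Lemma supnorm_ub (f : C) t : `|f t| <= supnorm f.
Proof.
by apply: ub_le_sup; [exact: supnorm_has_ubound | exists t].
Qed.

Lemma supnorm_void (f : C) : (K -> False) -> supnorm f = 0.
Proof.
move=> K0; have -> : supnorm f = sup set0; last exact: sup0.
by congr sup; apply/seteqP; split => // x [t]; case: (K0 t).
Qed.

Lemma supnorm_ge0 (f : C) : 0 <= supnorm f.
Proof.
have [[t _]|K0] := pselect (exists t : K, True).
  by apply: le_trans (supnorm_ub f t).
by rewrite supnorm_void// => t; apply: K0; exists t.
Qed.

Lemma supnorm_le (f : C) (M : R) :
  0 <= M -> (forall t, `|f t| <= M) -> supnorm f <= M.
Proof.
move=> M0 fM; have [[t _]|K0] := pselect (exists t : K, True).
  by apply: ge_sup; [exists `|f t|, t | move=> _ [s _ <-]].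
by rewrite supnorm_void// => t; apply: K0; exists t.
Qed.

Lemma supnormD (f g : C) : supnorm (f + g) <= supnorm f + supnorm g.
Proof.
apply: supnorm_le; first by rewrite addr_ge0 ?supnorm_ge0.
by move=> t; rewrite contfunD (le_trans (ler_normD _ _))// lerD ?supnorm_ub.
Qed.

Lemma supnormZ_le (l : R) (f : C) : supnorm (l *: f) <= `|l| * supnorm f.
Proof.
apply: supnorm_le; first by rewrite mulr_ge0 ?supnorm_ge0.
by move=> t; rewrite contfunZ normrZ ler_wpM2l ?supnorm_ub.
Qed.

Lemma supnormZ (l : R) (f : C) : supnorm (l *: f) = `|l| * supnorm f.
Proof.
apply/eqP; rewrite eq_le supnormZ_le/=.
have [->|l0] := eqVneq l 0; first by rewrite normr0 mul0r supnorm_ge0.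
rewrite -ler_pdivlMl ?normr_gt0// -normfV.
by rewrite -[X in supnorm X <= _](scalerK l0) supnormZ_le.
Qed.

Lemma supnorm0_eq0 (f : C) : supnorm f = 0 -> f = 0.
Proof.
move=> f0; apply: contfunP => t; apply/eqP.
by rewrite contfun0 -normr_le0 -f0 supnorm_ub.
Qed.

HB.instance Definition _ := Lmodule_isNormed.Build R C
  supnormD supnormZ supnorm0_eq0.

End contfun_normedModType.

Arguments contfun_cst {K} hK {R V} v.

(* Below, a set X in a normed space E stands for a linear subspace of E, with
   the norm of E. *)
Section subspaces.
Variables (R : realType) (E : normedModType R).

Definition unit_sphere (X : set E) : set E := [set x | X x /\ `|x| = 1].

Definition infinite_dimensional (X : set E) : Prop :=
  ~ exists (n : nat) (b : 'I_n -> E), (forall i, X (b i)) /\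
      forall f, X f -> exists l : 'I_n -> R, f = \sum_(i < n) l i *: b i.

Definition equiv_c0_basis (u : nat -> E) : Prop :=
  exists a b : R, [/\ 0 < a, a <= b &
    forall (p : nat) (l : 'I_p -> R),
      a * (\big[Num.max/0]_(j < p) `|l j|) <= `| \sum_(j < p) l j *: u j |
        <= b * (\big[Num.max/0]_(j < p) `|l j|)].

Definition sequential_SD2P (X : set E) : Prop :=
  forall (m : nat) (x : 'I_m -> E), (0 < m)%N ->
    (forall i, unit_sphere X (x i)) ->
    exists (y : 'I_m -> nat -> E) (z : nat -> E),
      [/\ (forall i n, unit_sphere X (y i n)) /\ (forall n, unit_sphere X (z n)),
          forall i, ((fun n => x i - y i n) @ \oo --> (0 : E)) \/
                    equiv_c0_basis (fun n => x i - y i n),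
          equiv_c0_basis z &
          forall i, ((fun n => `|y i n + z n|) @ \oo --> (1 : R)) /\
                    ((fun n => `|y i n - z n|) @ \oo --> (1 : R))].

End subspaces.

(* Closed unital point-separating subalgebras of C(K, A), where A, with product
   [mul], is to be the scalar field (real or complex). As [mul] is arbitrary
   here, pointwise products enter as "some continuous h in X is the product". *)
Record uniform_algebra (K : topologicalType) (hK : compact [set: K])
    (R : realType) (A : normedModType R) (mul : A -> A -> A)
    (X : set (contfun hK A)) : Prop := UniformAlgebra {
  uniform_algebra_closed : closed X ;
  uniform_algebraD : forall f g, X f -> X g -> X (f + g) ;
  uniform_algebraM : forall f g, X f -> X g ->
    exists2 h : contfun hK A, X h & forall t, h t = mul (f t) (g t) ;
  uniform_algebraZ : forall (c : A) f, X f ->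
    exists2 h : contfun hK A, X h & forall t, h t = mul c (f t) ;
  uniform_algebra_separates : forall s t : K, s <> t ->
    exists2 f, X f & f s <> f t ;
  uniform_algebra_cst : forall c : A, X (contfun_cst hK c)
}.

Definition real_uniform_algebra (K : topologicalType) (hK : compact [set: K])
    (R : realType) : set (contfun hK R^o) -> Prop :=
  uniform_algebra (fun a b : R^o => a * b).

Definition complex_uniform_algebra (K : topologicalType)
    (hK : compact [set: K]) (R : realType) :
    set (contfun hK (Rcomplex R)) -> Prop :=
  uniform_algebra (fun a b : Rcomplex R => a * b).

(* Main.v *)
Require Import Defs.
From mathcomp Require Import all_boot all_order all_algebra.
From mathcomp Require Import complex ring lra.
From mathcomp Require Import boolp classical_sets functions cardinality reals.
From mathcomp Require Import topology normedtype sequences derive.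

Set Implicit Arguments.
Unset Strict Implicit.
Unset Printing Implicit Defensive.

Import Order.TTheory GRing.Theory Num.Theory.
Import numFieldNormedType.Exports.

Local Open Scope classical_set_scope.
Local Open Scope ring_scope.

(** Let S be a minimal closed boundary of X: a closed set on which every modulus
of a function of X attains its maximum over K, no smaller closed set having
this property ([minimal_boundary]). Norms of elements of X may then be computed
on S alone. By minimality, every open set V meeting S carries a function of X
of norm one that equals 1 at a point of V and is small on S off V
([exists_peak]).

The construction needs functions z of this kind with |z| + |1 - z| almost at
most 1 on S, i.e. with values near the segment [0, 1]. An average of N such
peak functions has this property if each of them peaks inside the set where the
previous ones are almost 1: at every point the first few terms are almost 1,
the last ones almost 0, and at most one term is not controlled ([exists_bump]).

If X is infinite-dimensional, then S is infinite ([boundary_infinite]), since a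
function of X is determined by its values on S and X interpolates on finite
sets. So S has a limit point t0, close to which there are pairwise disjoint open
sets V_n meeting S ([disjoint_opens_at_limit_point]). Let z_n be such a function
for V_n. A function x of the unit sphere is replaced by y_n, the normalization
of x (1 - z_n). The norm of x (1 - z_n) is close to 1, because x attains its
norm at a point of S off V_n, and |y_n| + |z_n| is almost at most
|1 - z_n| + |z_n|. This gives the limits of the norms of y_n + z_n and
y_n - z_n ([perturb_off_bump]). The functions z_n have almost disjoint supports,
hence are equivalent to the c0 basis ([equiv_c0_basis_disjoint_bumps]). The
differences x - y_n are close to x z_n; if the V_n are chosen so that x is
nearly equal to x(t0) on V_n, they tend to 0 if x(t0) = 0 and are equivalent to
the c0 basis otherwise.

The real and the complex case are treated together: the scalar field enters
only through the multiplicativity of its norm, the existence of inverses and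
its finite dimension over the reals. *)

(** * The scalar field *)

Record normed_division_algebra (R : realType) (A : normedModType R)
    (mul : A -> A -> A) (e : A) : Prop := NormedDivisionAlgebra {
  nda_mulBr : forall a b c, mul a (b - c) = mul a b - mul a c ;
  nda_mulZl : forall (l : R) a b, mul (l *: a) b = l *: mul a b ;
  nda_mul1 : forall a, mul e a = a ;
  nda_mulr1 : forall a, mul a e = a ;
  nda_norm_mul : forall a b, `|mul a b| = `|a| * `|b| ;
  nda_norm_one : `|e| = 1 ;
  nda_mul_inv : forall a, a != 0 -> exists b, mul b a = e ;
  nda_finite_span : exists (d : nat) (u : 'I_d -> A),
    forall a, exists l : 'I_d -> R, a = \sum_(k < d) l k *: u k }.

(** * Disjoint open sets near a limit point *)

Section topology.
Variables (K : topologicalType) (hausK : hausdorff_space K).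

(** The complements in S of finite sets generate a filter; its cluster points are
limit points of S. *)
Lemma compact_limit_point (S : set K) :
  compact S -> infinite_set S -> limit_point S !=set0.
Proof.
move=> cS iS.
pose F := filter_from [set B : set K | finite_set B] (fun B => S `\` B).
have FF : Filter F.
  apply: filter_from_filter; first by exists set0; exact: finite_set0.
  move=> B C /= fB fC; exists (B `|` C); first by rewrite /= finite_setU.
  by move=> t [St BCt]; split; split=> // ?; apply: BCt; [left|right].
have PF : ProperFilter F.
  apply: filter_from_proper => B /= fB; apply: infinite_setN0.
  exact: infinite_setD.
have FS : F S.
  by exists set0; [exact: finite_set0|rewrite setD0].
have [t [_ tF]] := cS F PF FS.
exists t => U tU.
have [|s [[Ss ts] Us]] := tF (S `\ t) U _ tU.
  by exists [set t]; [exact: finite_set1|].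
by exists s; split => //; apply/eqP.
Qed.

(** The sets are separated from t0 one after the other: each choice leaves a
smaller open neighbourhood W of t0, disjoint from the sets chosen so far, in
which the next set is to lie. *)
Lemma disjoint_opens_at_limit_point (S : set K) (t0 : K) (O : nat -> set K) :
  limit_point S t0 -> (forall n, nbhs t0 (O n)) ->
  exists V : nat -> set K, [/\ forall n, open (V n), forall n, V n `<=` O n,
    forall n, V n `&` S !=set0, forall n, ~ V n t0 &
    forall j k, j != k -> V j `&` V k = set0].
Proof.
move=> St0 Ot0.
pose good (n : nat) (W : set K) (p : set K * set K) :=
  [/\ open p.1, p.1 `<=` O n `&` W, p.1 `&` S !=set0,
      open_nbhs t0 p.2 & p.2 `<=` W /\ p.1 `&` p.2 = set0].
have step n (W : set K) : exists p, open_nbhs t0 W -> good n W p.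
  (* The pair (set0, set0) is a dummy value: only neighbourhoods W occur. *)
  have [Wt0|nW] := pselect (open_nbhs t0 W); last by exists (set0, set0).
  have [s [st0 Ss [Os Ws]]] := St0 _ (filterI (nbhs_interior (Ot0 n)) (open_nbhs_nbhs Wt0)).
  move: hausK; rewrite open_hausdorff => /(_ s t0 st0)[[V1 V2]/=].
  rewrite !inE => -[V1s V2t] [oV1 oV2 V12].
  exists (V1 `&` (interior (O n) `&` W), V2 `&` W) => _; split => /=.
  - by apply: openI => //; apply: openI; [exact: open_interior|case: Wt0].
  - by move=> t [_ [/interior_subset ? ?]].
  - by exists s.
  - by apply: open_nbhsI => //; split.
  - split; first exact: subIsetr.
    by rewrite setIACA V12 set0I.
pose f n W := projT1 (cid (step n W)).
have fP n W : open_nbhs t0 W -> good n W (f n W) by exact: projT2 (cid (step n W)).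
pose W := fix W n := if n is n'.+1 then (f n' (W n')).2 else setT.
have Wt n : open_nbhs t0 (W n).
  elim: n => [|n IH] /=; first by split => //; exact: openT.
  by case: (fP n _ IH).
have Wle j k : (j <= k)%N -> W k `<=` W j.
  elim: k => [|k IH]; first by rewrite leqn0 => /eqP->.
  rewrite leq_eqVlt => /orP[/eqP-> //|/IH]; apply: subset_trans => /=.
  by case: (fP k _ (Wt k)) => _ _ _ _ [].
exists (fun n => (f n (W n)).1); split.
- by move=> n; case: (fP n _ (Wt n)).
- by move=> n t Vt; case: (fP n _ (Wt n)) => _ /(_ t Vt) [].
- by move=> n; case: (fP n _ (Wt n)).
- move=> n Vt; case: (fP n _ (Wt n)) => _ _ _ [_ ft] [_ d].
  suff : set0 t0 by [].
  by rewrite -d.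
- have main j k : (j < k)%N -> (f j (W j)).1 `&` (f k (W k)).1 = set0.
    move=> jk; apply/seteqP; split => [t [tj tk]|t []].
    case: (fP j _ (Wt j)) => _ _ _ _ [_ <-]; split => //.
    case: (fP k _ (Wt k)) => _ /(_ t tk) [_ Wkt] _ _ _.
    exact: (Wle j.+1 k).
  move=> j k; rewrite neq_ltn => /orP[/main//|/main]; by rewrite setIC.
Qed.

End topology.

(** * Boundaries *)

Section algebra.
Variables (R : realType) (K : topologicalType) (hK : compact [set: K]).
Variable A : normedModType R.
Local Notation C := (contfun hK A).

Lemma norm_continuous_contfun (f : C) : continuous (fun t => `|f t|).
Proof. by move=> t; apply: cvg_norm; exact: contfun_continuous. Qed.

Lemma closed_norm_ge (f : C) (c : R) : closed [set t | c <= `|f t|].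
Proof.
have /continuous_closedP h := @norm_continuous_contfun f.
exact: h _ (@closed_ge R c).
Qed.

Lemma open_norm_lt (f : C) (c : R) : open [set t | `|f t| < c].
Proof.
have /continuousP h := @norm_continuous_contfun f.
exact: h _ (@open_lt R c).
Qed.

Lemma contfun_norm_max (f : C) (S : set K) : closed S -> S !=set0 ->
  exists2 t, S t & forall s, S s -> `|f s| <= `|f t|.
Proof.
move=> cS S0; have kS : compact S by exact: subclosed_compact cS hK _.
have [|t] := compact_EVT_max S0 kS (f := fun t => `|f t|).
  exact/continuous_subspaceT/norm_continuous_contfun.
by rewrite inE => St h; exists t => // s Ss; apply: h; rewrite inE.
Qed.

Definition boundary (X : set C) (S : set K) : Prop :=
  forall f, X f -> forall s, exists2 t, S t & `|f s| <= `|f t|.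

Lemma boundary_norm_le (X : set C) (S : set K) (f : C) (M : R) :
  boundary X S -> X f -> 0 <= M -> (forall t, S t -> `|f t| <= M) -> `|f| <= M.
Proof.
move=> bS Xf M0 h; apply: supnorm_le => // s.
by have [t St] := bS f Xf s; move/le_trans; apply; exact: h.
Qed.

Lemma boundary_norm_max (X : set C) (S : set K) (f : C) :
  closed S -> boundary X S -> S !=set0 -> X f -> exists2 t, S t & `|f t| = `|f|.
Proof.
move=> cS bS S0 Xf; have [t St h] := contfun_norm_max f cS S0.
exists t => //; apply/le_anti/andP; split; first exact: supnorm_ub.
exact: boundary_norm_le bS Xf _ h.
Qed.

(** Zorn's lemma, applied to the open complements of boundaries. The union U of a
chain of them has again a boundary as complement: for given f and s, the points
off each member where the modulus of f is at least its value at s form a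
decreasing family of nonempty closed sets, which by compactness has a common
point. *)
Lemma minimal_boundary (X : set C) : K -> exists S : set K,
  [/\ closed S, boundary X S &
    forall V, open V -> V `&` S !=set0 -> ~ boundary X (S `\` V)].
Proof.
move=> k0; pose P (U : set K) := open U /\ boundary X (~` U).
have [U [[oU bU] Umax]] : exists U, P U /\ forall B, U `<` B -> ~ P B.
  apply: Zorn_bigcup => F FP Ftot.
  split; first by apply: bigcup_open => U /FP[].
  (* The empty chain has union set0, whose complement is K. *)
  move=> f Xf s; have [[U0 FU0]|nF] := pselect (F !=set0); last first.
    by exists s => // -[U FU _]; apply: nF; exists U.
  pose B (U : set K) := ~` U `&` [set t | `|f s| <= `|f t|].
  have FF : Filter (filter_from F B).
    apply: filter_from_filter; first by exists U0.
    move=> U V FU FV; have [UV|VU] := Ftot U V FU FV.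
      by exists V => // t [nV ft]; split; split => // /UV.
    by exists U => // t [nU ft]; split; split => // /VU.
  have PF : ProperFilter (filter_from F B).
    apply: filter_from_proper => U FU; have [_ /(_ f Xf s)[t Ut ft]] := FP U FU.
    by exists t.
  have [t [_ tF]] := hK PF filterT.
  have tB U : F U -> B U t.
    move=> FU; have cB : closed (B U).
      apply: closedI; last exact: closed_norm_ge.
      by apply: open_closedC; have [] := FP U FU.
    by apply: cB => W tW; apply: tF => //; exists U.
  exists t; last by case: (tB _ FU0).
  by move=> [U FU Ut]; case: (tB _ FU).
exists (~` U); split => //; first exact: open_closedC.
move=> V oV [t [Vt nUt]] bV; apply: (Umax (U `|` V)).
  by split; [exact: subsetUl|move=> /(_ t (or_intror Vt))].
by split; [exact: openU|rewrite setCU].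
Qed.

(** * Uniform algebras over a normed division algebra *)

Section uniform_algebra.
Variables (mul : A -> A -> A) (e : A).
Hypothesis HA : normed_division_algebra mul e.
Variable X : set C.
Hypothesis HX : uniform_algebra mul X.

Lemma uaZ (l : R) f : X f -> X (l *: f).
Proof.
move=> Xf; have [h Xh hE] := uniform_algebraZ HX (l *: e) Xf.
suff -> : l *: f = h by [].
by apply: contfunP => t; rewrite hE (nda_mulZl HA) (nda_mul1 HA).
Qed.

Lemma uaB f g : X f -> X g -> X (f - g).
Proof.
by move=> Xf Xg; apply: (uniform_algebraD HX) => //; rewrite -scaleN1r; exact: uaZ.
Qed.

Lemma ua0 : X 0.
Proof. exact: (uniform_algebra_cst HX 0). Qed.

Lemma ua_sum n (l : 'I_n -> R) (u : 'I_n -> C) :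
  (forall i, X (u i)) -> X (\sum_(i < n) l i *: u i).
Proof.
move=> Xu; elim/big_ind : _ => [|f g|i _]; [exact: ua0|exact: (uniform_algebraD HX)|].
exact: uaZ.
Qed.

Lemma contfun_sumE n (l : 'I_n -> R) (u : 'I_n -> C) t :
  (\sum_(i < n) l i *: u i) t = \sum_(i < n) l i *: u i t.
Proof.
elim: n l u => [|n IH] l u; first by rewrite !big_ord0.
by rewrite !big_ord_recl contfunD IH.
Qed.

Lemma ua_exp f n : X f ->
  exists2 h : C, X h & forall t, `|h t| = `|f t| ^+ n /\ (f t = e -> h t = e).
Proof.
move=> Xf; elim: n => [|n [h Xh hP]].
  exists (contfun_cst hK e); first exact: (uniform_algebra_cst HX).
  by move=> t; rewrite expr0 -(nda_norm_one HA).
have [g Xg gE] := uniform_algebraM HX Xf Xh.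
exists g => // t; have [h1 h2] := hP t; rewrite gE (nda_norm_mul HA) h1 exprS; split => //.
by move=> fe; rewrite fe h2// (nda_mul1 HA).
Qed.

Lemma mulx0 a : mul a 0 = 0.
Proof. by apply/normr0_eq0; rewrite (nda_norm_mul HA) normr0 mulr0. Qed.

Lemma mul0x a : mul 0 a = 0.
Proof. by apply/normr0_eq0; rewrite (nda_norm_mul HA) normr0 mul0r. Qed.

(** A product of functions f - f(q), for q in the list, each rescaled to equal 1
at p. *)
Lemma ua_interpolation (p : K) (s : seq K) : p \notin s ->
  exists2 h : C, X h & h p = e /\ forall q, q \in s -> h q = 0.
Proof.
elim: s => [|q s IH].
  by exists (contfun_cst hK e) => //; exact: (uniform_algebra_cst HX).
rewrite inE negb_or => /andP[pq /IH[h Xh [hp hs]]].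
have [f Xf fpq] := uniform_algebra_separates HX (elimN eqP pq).
have [b bE] := nda_mul_inv HA (a := f p - f q) (ltac:(by rewrite subr_eq0; apply/eqP)).
have Xg := uaB Xf (uniform_algebra_cst HX (f q)).
have [g1 Xg1 g1E] := uniform_algebraZ HX b Xg.
have [g2 Xg2 g2E] := uniform_algebraM HX Xh Xg1.
exists g2 => //; split.
  by rewrite g2E g1E hp (nda_mul1 HA) -bE.
move=> r; rewrite inE g2E g1E => /predU1P[->|/hs ->]; last exact: mul0x.
by rewrite contfunD contfunN subrr !mulx0.
Qed.

(** If S is finite, the interpolating functions at the points of S, multiplied by
the elements of a real spanning family of A, span X: an element of X is
determined by its values on the boundary S. *)
Lemma boundary_infinite (S : set K) :
  infinite_dimensional X -> boundary X S -> infinite_set S.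
Proof.
move=> iX bS /finite_seqP[s0 Ss0]; apply: iX.
pose s := undup s0; have us : uniq s := undup_uniq _.
have Ss : S = [set` s] by rewrite Ss0; apply/seteqP; split => t /=; rewrite mem_undup.
have [d [u uP]] := nda_finite_span HA.
pose N := size s.
have hex (j : 'I_N) : exists h, X h /\ forall i : 'I_N,
    h (tnth (in_tuple s) i) = if i == j then e else 0.
  have [|h Xh [h1 h2]] := @ua_interpolation (tnth (in_tuple s) j)
     (rem (tnth (in_tuple s) j) s).
    by rewrite mem_rem_uniq// inE eqxx.
  exists h; split => // i; case: eqP => [->//|ij]; apply: h2.
  rewrite mem_rem_uniq// inE mem_tnth andbT.
  apply/eqP; exact: contra_not (tuple_uniqP (in_tuple s) us i j) ij.
have [h hP] := choice hex.
have gex (p : 'I_N * 'I_d) : exists g, X g /\ forall t, g t = mul (u p.2) (h p.1 t).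
  have [g Xg gE] := uniform_algebraZ HX (u p.2) (hP p.1).1.
  by exists g.
have [g gP] := choice gex.
pose I : finType := ('I_N * 'I_d)%type.
exists #|I|, (fun k => g (enum_val k)); split; first by move=> i; exact: (gP _).1.
move=> f Xf.
have [l lP] := choice (fun i : 'I_N => uP (f (tnth (in_tuple s) i))).
exists (fun k => l (enum_val k).1 (enum_val k).2).
apply/eqP; rewrite -subr_eq0 -normr_le0; apply/(boundary_norm_le bS) => //.
  by apply: uaB => //; apply: ua_sum => i; exact: (gP _).1.
move=> t; rewrite Ss /= => ts.
have [i ->] := tnthP (in_tuple s) _ (ts : t \in in_tuple s).
rewrite normr_le0 contfunD contfunN subr_eq0 contfun_sumE; apply/eqP.
set c := tnth _ i.
rewrite -(@big_enum_val _ _ _ I xpredT (fun p => l p.1 p.2 *: g p c)) /=.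
rewrite (_ : \sum_(p in _) _ = \sum_j \sum_k l j k *: g (j, k) c); last first.
  by rewrite pair_big; apply: eq_big => -[].
rewrite (bigD1 i)//= [X in _ + X]big1 ?addr0; last first.
  move=> j ji; apply: big1 => k _; rewrite (gP _).2 /= (hP j).2 eq_sym (negbTE ji).
  by rewrite mulx0 scaler0.
rewrite {1}/c lP; apply: eq_bigr => k _; rewrite (gP _).2 /= (hP i).2 eqxx.
by rewrite (nda_mulr1 HA).
Qed.

End uniform_algebra.

(** * Peak functions on a minimal boundary *)

Section peaks.
Variables (mul : A -> A -> A) (e : A).
Hypothesis HA : normed_division_algebra mul e.
Variable X : set C.
Hypothesis HX : uniform_algebra mul X.
Variable S : set K.
Hypotheses (cS : closed S) (bS : boundary X S).
Hypothesis minS :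
  forall V, open V -> V `&` S !=set0 -> ~ boundary X (S `\` V).

(** As S minus V is no boundary, some f in X is larger somewhere than anywhere on
S minus V, so its modulus attains its maximum over S at a point t0 of V. Rescale
f to equal 1 at t0 and take a high power. *)
Lemma exists_peak (V : set K) (d : R) : open V -> V `&` S !=set0 -> 0 < d ->
  exists2 g : C, X g & exists t0, [/\ S t0, V t0, g t0 = e,
    forall t, S t -> `|g t| <= 1 & forall t, S t -> ~ V t -> `|g t| <= d].
Proof.
move=> oV VS d0.
have [SV0|nSV] := pselect (S `\` V !=set0); last first.
  exists (contfun_cst hK e); first exact: (uniform_algebra_cst HX).
  have [t [Vt St]] := VS; exists t; split => // [s _|s Ss nVs].
    by rewrite [leLHS](nda_norm_one HA).
  by exfalso; apply: nSV; exists s.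
have [f [Xf [s fs]]] : exists f, X f /\ exists s, forall t, S t -> ~ V t ->
    `|f t| < `|f s|.
  apply: contra_notP (minS oV VS) => nf f Xf s.
  apply: contra_notP nf => nt; exists f; split => //; exists s => t St nVt.
  by rewrite ltNge; apply/negP => ft; apply: nt; exists t.
have cSV : closed (S `\` V) by apply: closedI => //; exact: open_closedC.
have [r [Sr Vr] rmax] := contfun_norm_max f cSV SV0.
have S0 : S !=set0 by exists r.
have [t0 St0 t0max] := contfun_norm_max f cS S0.
have fst0 : `|f s| <= `|f t0|.
  by have [s' Ss' /le_trans] := bS Xf s; apply; exact: t0max.
have Vt0 : V t0.
  by apply: contrapT => /(fs _ St0); rewrite ltNge fst0.
have frt0 : `|f r| < `|f t0| := lt_le_trans (fs _ Sr Vr) fst0.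
have ft0 : 0 < `|f t0| := le_lt_trans (normr_ge0 _) frt0.
have [b bE] := nda_mul_inv HA (a := f t0) (ltac:(by rewrite -normr_gt0)).
have [g1 Xg1 g1E] := uniform_algebraZ HX b Xf.
have nb : `|b| = `|f t0|^-1.
  apply: (mulIf (lt0r_neq0 ft0)).
  by rewrite -(nda_norm_mul HA) bE (nda_norm_one HA) mulVf ?lt0r_neq0.
have ng1 t : `|g1 t| = `|f t| / `|f t0| by rewrite g1E (nda_norm_mul HA) nb mulrC.
have rho1 : `|f r| / `|f t0| < 1 by rewrite ltr_pdivrMr// mul1r.
have rho0 : 0 <= `|f r| / `|f t0| by rewrite divr_ge0.
have [n nP] : exists n, (`|f r| / `|f t0|) ^+ n < d.
  have h : (fun n => (`|f r| / `|f t0|) ^+ n) @ \oo --> (0 : R).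
    by apply: cvg_expr; rewrite ger0_norm.
  have [N _ NP] := (@cvgr_lt _ _ _ _ _ _ h d d0 : \forall n \near \oo, _).
  by exists N; apply: NP => /=.
have [h Xh hP] := ua_exp HA HX n Xg1.
exists h => //; exists t0; split => //.
- by apply: (hP t0).2; rewrite g1E.
- move=> t St; rewrite (hP t).1 ng1 exprn_ile1//; first by rewrite divr_ge0.
  by rewrite ler_pdivrMr// mul1r t0max.
- move=> t St nVt; rewrite (hP t).1 ng1; apply/ltW/(le_lt_trans _ nP).
  rewrite lerXn2r ?nnegrE//; first by rewrite divr_ge0.
  by rewrite ler_pM2r ?invr_gt0// rmax.
Qed.

(** The peak functions g_1, ..., g_N are chosen so that g_k peaks inside the open
set V_k on which g_1, ..., g_(k-1) are d-close to 1, and is d-small off it. At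
a point of V_k outside V_(k+1) the terms before g_k are almost 1 and those after
it almost 0, so the sum is within 1 + N d of an integer between 0 and N. The
estimate is stated with a real number r in place of that integer. *)
Lemma exists_nested_peaks_sum (N : nat) (d : R) (V : set K) :
  0 < d -> open V -> V `&` S !=set0 ->
  exists2 f : C, X f & exists t0, [/\ S t0, V t0,
    `|f t0 - N%:R *: e| <= N%:R * d & forall t, S t -> [/\ `|f t| <= N%:R,
      ~ V t -> `|f t| <= N%:R * d &
      exists2 r, 0 <= r <= N%:R & `|f t - r *: e| <= 1 + N%:R * d]].
Proof.
move=> d0; elim: N V => [|N IH] V oV VS.
  exists 0; first exact: (ua0 HX).
  have [t [Vt St]] := VS; exists t; split => // [|s Ss].
    by rewrite contfun0 scale0r subrr normr0 mul0r.
  rewrite contfun0 normr0 mul0r; split => //.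
  by exists 0; rewrite ?lexx// scale0r subrr normr0 addr0.
have [g Xg [t0 [St0 Vt0 gt0 g1 gd]]] := exists_peak oV VS d0.
pose V' := V `&` [set t | `|(g - contfun_cst hK e) t| < d].
have oV' : open V' by apply: openI => //; exact: open_norm_lt.
have [|f Xf [t1 [St1 [Vt1 gt1] ft1 fP]]] := IH V' oV'.
  exists t0; split => //; split => //=.
  by rewrite contfunD contfunN gt0 [_ - _]subrr normr0.
exists (g + f); first exact: (uniform_algebraD HX).
have split1 t r : (g + f) t - (1 + r) *: e = (g - contfun_cst hK e) t + (f t - r *: e).
  rewrite contfunD [in RHS]contfunD contfunN scalerDl scale1r opprD.
  by rewrite [in RHS]addrACA.
exists t1; split => //.
  rewrite -[N.+1]add1n natrD split1 mulrDl mul1r.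
  by rewrite (le_trans (ler_normD _ _))// lerD// ltW.
move=> t St; have [f1 f2 [r r01 fr]] := fP t St.
rewrite -[N.+1]add1n natrD mulrDl mul1r; split.
- by rewrite contfunD (le_trans (ler_normD _ _))// lerD// g1.
- move=> nVt; rewrite contfunD (le_trans (ler_normD _ _))// lerD ?gd//.
  by apply: f2 => -[].
- have [V't|nV't] := pselect (V' t).
    exists (1 + r); first by case/andP: r01 => r0 rN; apply/andP; split; lra.
    rewrite split1 (le_trans (ler_normD _ _))// addrCA lerD//.
    by rewrite ltW//; case: V't.
  exists 0; first by rewrite lexx addr_ge0.
  rewrite scale0r subr0 contfunD (le_trans (ler_normD _ _))// lerD//; first exact: g1.
  by rewrite (le_trans (f2 nV't))// lerDr ltW.
Qed.

(** The sum above for d = eta / 4 and N at least 2 / eta, divided by its norm,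
which lies between N (1 - d) and N. Distances to the segment [0, 1] are then at
most 1 / N + 2 d, which is at most eta. *)
Lemma exists_bump (eta : R) (V : set K) :
  0 < eta -> eta < 1 -> open V -> V `&` S !=set0 ->
  exists2 z : C, X z & [/\ `|z| = 1, exists2 p, S p /\ V p & `|z p| = 1,
    forall t, S t -> `|z t| + `|e - z t| <= 1 + 2 * eta &
    forall t, S t -> ~ V t -> `|z t| <= eta].
Proof.
move=> eta0 eta1 oV VS.
pose d := eta / 4; have d0 : 0 < d by rewrite /d; lra.
have [N [N0 Neta]] : exists N, 0 < N%:R :> R /\ N%:R^-1 <= eta / 2.
  have x0 : 0 < 2 / eta by rewrite divr_gt0.
  have NP := archi_boundP (ltW x0).
  have N0 := lt_trans x0 NP; exists (Num.bound (2 / eta)); split => //.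
  by rewrite -[leRHS]invrK lef_pV2 ?posrE ?invr_gt0 ?divr_gt0// invf_div ltW.
have [f Xf [t0 [St0 Vt0 ft0 fP]]] := exists_nested_peaks_sum N d0 oV VS.
have S0 : S !=set0 by exists t0.
have fN : `|f| <= N%:R.
  by apply: boundary_norm_le bS Xf (ltW N0) _ => t /fP[].
have Nf : N%:R * (1 - d) <= `|f|.
  apply: le_trans (supnorm_ub f t0).
  have : `|N%:R *: e| <= `|f t0| + N%:R * d.
    rewrite -[X in `|X|](subKr (f t0)) (le_trans (ler_normB _ _))// lerD2l.
    by rewrite ft0.
  rewrite normrZ (nda_norm_one HA) (ger0_norm (ltW N0)) => h; lra.
have f0 : 0 < `|f| by apply: lt_le_trans Nf; rewrite mulr_gt0// /d; lra.
have Vf0 : 0 <= `|f|^-1 by rewrite invr_ge0 ltW.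
have VN0 : 0 <= N%:R^-1 :> R by rewrite invr_ge0 ltW.
pose z := `|f|^-1 *: f.
have Xz : X z by exact: (uaZ HA HX).
have nz : `|z| = 1.
  by rewrite normrZ (ger0_norm Vf0) mulVf// lt0r_neq0.
have zV t : S t -> ~ V t -> `|z t| <= eta.
  move=> St nVt; have [_ /(_ nVt) ft _] := fP t St.
  rewrite contfunZ normrZ (ger0_norm Vf0) mulrC ler_pdivrMr//.
  rewrite (le_trans ft)// (le_trans _ (ler_wpM2l (ltW eta0) Nf))//.
  rewrite mulrCA ler_pM2l// /d; nra.
exists z => //; split => //.
  have [p Sp zp] := boundary_norm_max cS bS S0 Xz; rewrite nz in zp.
  exists p => //; split => //; apply: contrapT => /(zV p Sp); rewrite zp; lra.
move=> t St; have [f1 _ [r /andP[r0 rN] fr]] := fP t St.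
pose q := r / N%:R.
have q0 : 0 <= q by rewrite divr_ge0// ltW.
have q1 : q <= 1 by rewrite ler_pdivrMr// mul1r.
have zq : `|z t - q *: e| <= eta.
  have -> : z t - q *: e = (`|f|^-1 - N%:R^-1) *: f t + N%:R^-1 *: (f t - r *: e).
    rewrite contfunZ scalerBl scalerBr addrA subrK /q.
    by rewrite scalerA mulrC.
  have ea : `|(`|f|^-1 - N%:R^-1) *: f t| <= d.
    rewrite normrZ ger0_norm; last by rewrite subr_ge0 lef_pV2 ?posrE.
    have ftf := supnorm_ub f t; rewrite -[supnorm f]/(`|f|) in ftf.
    apply: (@le_trans _ _ ((`|f|^-1 - N%:R^-1) * `|f|)).
      by rewrite ler_wpM2l// subr_ge0 lef_pV2 ?posrE.
    rewrite mulrBl mulVf ?lt0r_neq0// lerBlDr -lerBlDl mulrC ler_pdivlMr//.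
    by rewrite mulrC.
  have eb : `|N%:R^-1 *: (f t - r *: e)| <= N%:R^-1 + d.
    rewrite normrZ (ger0_norm VN0) mulrC ler_pdivrMr//.
    by rewrite mulrDl mulVf ?lt0r_neq0// [d * _]mulrC.
  apply: le_trans (ler_normD _ _) _.
  move: ea eb Neta; rewrite /d; lra.
have z1 : `|z t| <= q + eta.
  rewrite -[z t](subrK (q *: e)) (le_trans (ler_normD _ _))// addrC.
  by rewrite normrZ (nda_norm_one HA) ger0_norm// mulr1 lerD2l.
have z2 : `|e - z t| <= (1 - q) + eta.
  have -> : e - z t = (1 - q) *: e - (z t - q *: e).
    by rewrite scalerBl scale1r opprB addrA subrK.
  rewrite (le_trans (ler_normB _ _))//.
  by rewrite normrZ (nda_norm_one HA) ger0_norm ?subr_ge0// mulr1 lerD2l.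
lra.
Qed.

End peaks.

(** * Sequences equivalent to the c0 basis *)

Lemma sum_geometric_half (k : R) p :
  \sum_(j < p) k * (1 / 2) ^+ j = 2 * k - 2 * (k * (1 / 2) ^+ p).
Proof.
elim: p => [|p IH]; first by rewrite big_ord0 expr0; ring.
by rewrite big_ord_recr/= IH exprS; field.
Qed.

(** At a point of S at most one u_n is not bounded by th n, and the remaining ones
add up to at most a / 2 times the largest coefficient. *)
Lemma equiv_c0_basis_disjoint_bumps (X : set C) (S : set K) (V : nat -> set K)
    (u : nat -> C) (th : nat -> R) (a B : R) :
  boundary X S -> (forall p (l : 'I_p -> R), X (\sum_(j < p) l j *: u j)) ->
  (forall j k, j != k -> V j `&` V k = set0) ->
  0 < a -> (forall n, 0 <= th n) -> (forall p, \sum_(j < p) th j <= a / 2) ->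
  (forall n, `|u n| <= B) ->
  (forall n t, S t -> ~ V n t -> `|u n t| <= th n) ->
  (forall n, exists2 t, S t /\ V n t & a <= `|u n t|) ->
  equiv_c0_basis u.
Proof.
move=> bS Xu dV a0 th0 thS uB uth ua.
have B0 : 0 <= B by exact: le_trans (normr_ge0 _) (uB 0).
exists (a / 2), (B + a / 2); split; [by rewrite divr_gt0|by rewrite lerDr|].
move=> p l; set M := \big[Num.max/0]_(j < p) _.
have lM j : `|l j| <= M by exact: (le_bigmax _ (fun j => `|l j|)).
have M0 : 0 <= M by exact: bigmax_ge_id.
have tail t (P : pred 'I_p) : S t -> (forall j, P j -> ~ V j t) ->
    `|\sum_(j < p | P j) l j *: u j t| <= M * (a / 2).
  move=> St nV; apply: le_trans (ler_norm_sum _ _ _) _.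
  apply: le_trans (ler_wpM2l M0 (thS p)); rewrite mulr_sumr big_mkcond /=.
  apply: ler_sum => j _; case: ifPn => [Pj|_]; last exact: mulr_ge0.
  by rewrite normrZ ler_pM// uth//; exact: nV.
have only t (k : 'I_p) : V k t -> forall j : 'I_p, j != k -> ~ V j t.
  by move=> Vk j jk Vj; have : (V j `&` V k) t by []; rewrite dV.
apply/andP; split; last first.
  apply: boundary_norm_le bS (Xu p l) _ _.
    by rewrite mulr_ge0// addr_ge0// divr_ge0// ltW.
  move=> t St; rewrite contfun_sumE.
  have [[k Vk]|nV] := pselect (exists k : 'I_p, V k t).
    rewrite (bigD1 k)//= mulrDl (le_trans (ler_normD _ _))// lerD//.
      rewrite normrZ mulrC ler_pM//; exact: le_trans (supnorm_ub _ _) (uB k).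
    by rewrite [leRHS]mulrC; apply: tail => // j; exact: only.
  rewrite mulrDl -[leLHS]add0r lerD//; first exact: mulr_ge0.
  rewrite [leRHS]mulrC; apply: (tail t xpredT) => // j _ Vj.
  by apply: nV; exists j.
set sigma := \sum_(j < p) _.
suff : M <= (`|sigma| + M * (a / 2)) / a by rewrite ler_pdivlMr//; lra.
apply: bigmax_le.
  apply: divr_ge0 (ltW a0); apply: addr_ge0 => //.
  by apply: mulr_ge0 => //; apply: divr_ge0 => //; exact: ltW.
move=> k _; rewrite ler_pdivlMr//.
have [t [St Vt] at_] := ua k.
have st : `|sigma t| <= `|sigma| := supnorm_ub sigma t.
have : `|l k *: u k t| <= `|sigma t| + M * (a / 2).
  rewrite contfun_sumE (bigD1 k)//=.
  set r := \sum_(j < p | _) _; rewrite -[X in `|X| <= _](addrK r).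
  rewrite (le_trans (ler_normB _ _))// lerD2l.
  by apply: tail => // j; exact: only.
rewrite normrZ => h.
have := ler_wpM2l (normr_ge0 (l k)) at_; lra.
Qed.

(** * The sequential strong diameter two property *)

Section sequential_SD2P.
Variables (mul : A -> A -> A) (e : A).
Hypothesis HA : normed_division_algebra mul e.
Variable X : set C.
Hypothesis HX : uniform_algebra mul X.

(** The function y is the normalization of x - x z. On S the modulus of x - x z is
at most that of 1 - z, hence at most 1 + 2 eta, and at the norming point s off V
it is at least 1 - eta. So the normalizing factor 1 / c differs from 1 by at most
4 eta, and x - y differs from x z / c by at most 4 eta. *)
Lemma perturb_off_bump (S V : set K) (x z : C) (s : K) (eta : R) :
  boundary X S -> 0 < eta -> eta <= 1 / 4 ->
  X x -> `|x| = 1 -> S s -> ~ V s -> `|x s| = 1 ->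
  X z -> (forall t, S t -> `|z t| + `|e - z t| <= 1 + 2 * eta) ->
  (forall t, S t -> ~ V t -> `|z t| <= eta) ->
  exists2 y : C, X y & [/\ `|y| = 1,
    `|y + z| <= 1 + 10 * eta /\ `|y - z| <= 1 + 10 * eta,
    forall t, `|(x - y) t| <= 4 * eta + 2 * (`|x t| * `|z t|) &
    forall t, `|x t| * `|z t| / 2 - 4 * eta <= `|(x - y) t|].
Proof.
move=> bS eta0 eta4 Xx nx Ss nVs xs Xz zS zV.
have [h Xh hE] := uniform_algebraM HX Xx Xz.
have x1 t : `|x t| <= 1 by rewrite -nx; exact: supnorm_ub.
pose w := x - h; have Xw : X w := uaB HA HX Xx Xh.
have wE t : `|w t| = `|x t| * `|e - z t|.
  by rewrite contfunD contfunN hE -(nda_norm_mul HA) (nda_mulBr HA) (nda_mulr1 HA).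
have c_le : `|w| <= 1 + 2 * eta.
  apply: boundary_norm_le bS Xw _ _; first lra.
  move=> t /zS zt; rewrite wE.
  have := ler_wpM2r (normr_ge0 (e - z t)) (x1 t).
  have := normr_ge0 (z t); lra.
have c_ge : 1 - eta <= `|w|.
  apply: le_trans (supnorm_ub w s); rewrite wE xs mul1r.
  have := zV s Ss nVs; have := ler_normB e (e - z s).
  rewrite subKr; have := ler_normD (e - z s) (z s).
  rewrite subrK (nda_norm_one HA); lra.
set c := `|w| in c_le c_ge.
have c0 : 0 < c by lra.
have Vc0 : 0 <= c^-1 by rewrite invr_ge0 ltW.
have Vc2 : c^-1 <= 2.
  by rewrite -[leRHS]invrK lef_pV2 ?posrE ?invr_gt0//; lra.
have Vch : 1 / 2 <= c^-1.
  by rewrite div1r lef_pV2 ?posrE//; lra.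
have Vc1 : `|1 - c^-1| <= 4 * eta.
  have -> : 1 - c^-1 = (c - 1) * c^-1 by rewrite mulrBl mul1r divff ?lt0r_neq0.
  rewrite normrM (ger0_norm Vc0) (_ : 4 * eta = (2 * eta) * 2); last by ring.
  by rewrite ler_pM// ler_norml; apply/andP; split; lra.
pose y := c^-1 *: w; have Xy : X y := uaZ HA HX _ Xw.
have ny : `|y| = 1 by rewrite normrZ (ger0_norm Vc0) mulVf ?lt0r_neq0.
have yE t : `|y t| = c^-1 * (`|x t| * `|e - z t|).
  by rewrite contfunZ normrZ (ger0_norm Vc0) wE.
have yz t : S t -> `|y t| + `|z t| <= 1 + 10 * eta.
  move=> /zS zt.
  have h1 : `|y t| <= c^-1 * `|e - z t|.
    by rewrite yE ler_wpM2l// ler_piMl.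
  have h2 : c^-1 <= 1 + 4 * eta by move: Vc1; rewrite ler_norml; lra.
  have h3 := ler_wpM2r (normr_ge0 (e - z t)) h2.
  have h4 : eta * `|e - z t| <= eta * 2.
    by rewrite ler_pM2l//; have := normr_ge0 (z t); lra.
  lra.
have xy t : (x - y) t = (1 - c^-1) *: x t + c^-1 *: mul (x t) (z t).
  rewrite contfunD contfunN contfunZ contfunD contfunN hE.
  by rewrite scalerBl scale1r scalerBr opprB addrA addrAC.
have n1 t : `|(1 - c^-1) *: x t| <= 4 * eta.
  by rewrite normrZ -[4 * eta]mulr1 ler_pM.
have n2 t : `|c^-1 *: mul (x t) (z t)| = c^-1 * (`|x t| * `|z t|).
  by rewrite normrZ (ger0_norm Vc0) (nda_norm_mul HA).
exists y => //; split => //.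
- split; apply: boundary_norm_le bS _ _ _ => //.
  + exact: (uniform_algebraD HX).
  + lra.
  + by move=> t St; rewrite contfunD (le_trans (ler_normD _ _))// yz.
  + exact: (uaB HA HX).
  + lra.
  + move=> t St; rewrite contfunD contfunN.
    by rewrite (le_trans (ler_normB _ _))// yz.
- move=> t; rewrite xy (le_trans (ler_normD _ _))// lerD// n2.
  by rewrite ler_wpM2r// mulr_ge0.
- move=> t; rewrite xy.
  have := ler_normB ((1 - c^-1) *: x t + c^-1 *: mul (x t) (z t)) ((1 - c^-1) *: x t).
  rewrite addrAC subrr add0r n2.
  have := n1 t.
  have : 1 / 2 * (`|x t| * `|z t|) <= c^-1 * (`|x t| * `|z t|).
    by rewrite ler_wpM2r// mulr_ge0.
  lra.
Qed.

(** Equivalence to the c0 basis concerns all terms of a sequence and not only its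
tail, so the errors are chosen small, already for n = 0, compared with the
smallest nonzero modulus of an x_i at t0. *)
Lemma uniform_algebra_sequential_SD2P :
  hausdorff_space K -> infinite_dimensional X -> sequential_SD2P X.
Proof.
move=> hausK iX m x m0 xS.
have Xx i : X (x i) := (xS i).1.
have nx i : `|x i| = 1 := (xS i).2.
have [[k0 _]|K0] := pselect (exists k : K, True); last first.
  have := nx (Ordinal m0); rewrite [LHS]supnorm_void; last by move=> k; apply: K0; exists k.
  by move/esym/eqP; rewrite oner_eq0.
have [S [cS bS minS]] := minimal_boundary X k0.
have iS : infinite_set S := boundary_infinite HA HX iX bS.
have S0 : S !=set0 := infinite_setN0 iS.
have [t0 limt0] := compact_limit_point (subclosed_compact cS hK (@subsetT _ S)) iS.
have /choice[s sP] : forall i, exists s, S s /\ `|x i s| = 1.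
  move=> i.
  by have [t St] := boundary_norm_max cS bS S0 (Xx i); rewrite nx; exists t.
have [kap [kap0 kap1 kapP]] : exists kap : R, [/\ 0 < kap, kap <= 1 &
    forall i, x i t0 != 0 -> kap <= `|x i t0|].
  exists (\big[Num.min/1]_(i < m | x i t0 != 0) `|x i t0|); split.
  - by apply: lt_bigmin => // i; rewrite normr_gt0.
  - exact: bigmin_le_id.
  - by move=> i xi; exact: bigmin_le_cond.
(* The errors 6 eta n of x i - y n off V n sum up to at most 3/16 kap, half of the
   lower bound 3/8 kap for x i - y n at the points of V n where z n has modulus 1,
   if x i t0 is nonzero. *)
pose eta n : R := kap / 64 * (1 / 2) ^+ n.
have half n : 0 < (1 / 2 : R) ^+ n <= 1.
  by rewrite exprn_gt0 ?exprn_ile1//; lra.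
have eta0 n : 0 < eta n.
  by rewrite /eta mulr_gt0 ?divr_gt0//; case/andP: (half n).
have eta_le n : eta n <= kap / 64.
  rewrite -[leRHS]mulr1 ler_wpM2l//; first by rewrite divr_ge0// ltW.
  by case/andP: (half n).
have eta_cvg : eta @ \oo --> (0 : R).
  rewrite -(mulr0 (kap / 64)); apply: cvgM; first exact: cvg_cst.
  by apply: cvg_expr; rewrite ger0_norm; lra.
(* On O n the x i are almost constant and their norming points are excluded,
   except for t0 itself, which lies in no V n. *)
pose O n := [set t | forall i, `|(x i - contfun_cst hK (x i t0)) t| < eta n /\
  (s i <> t0 -> t <> s i)].
have Ot0 n : nbhs t0 (O n).
  apply: filter_forall => i; apply: filterI.
    apply: open_nbhs_nbhs; split; first exact: open_norm_lt.
    by rewrite /= contfunD contfunN [_ - _]subrr normr0.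
  have [->|st] := pselect (s i = t0); first by apply: nearW.
  apply: filterS (_ : nbhs t0 (~` [set s i])) => [t ts _ //|].
  apply: open_nbhs_nbhs; split; last by move=> /esym.
  by apply: closed_openC; apply: accessible_closed_set1; exact: hausdorff_accessible.
have [V [oV VO VS Vt0 dV]] := disjoint_opens_at_limit_point hausK limt0 Ot0.
have Vs i n : ~ V n (s i).
  move=> Vsi; have [_ h] := VO n _ Vsi i.
  by have [st|st] := pselect (s i = t0); [apply: (Vt0 n); rewrite -st|exact: h].
have eta1 n : eta n < 1 by have := eta_le n; lra.
have eta4 n : eta n <= 1 / 4 by have := eta_le n; lra.
have /choice[z zP] : forall n, exists z : C, [/\ X z, `|z| = 1,
    exists2 p, S p /\ V n p & `|z p| = 1,
    forall t, S t -> `|z t| + `|e - z t| <= 1 + 2 * eta n &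
    forall t, S t -> ~ V n t -> `|z t| <= eta n].
  move=> n.
  have [zn Xz [h1 h2 h3 h4]] := exists_bump HA HX cS bS minS (eta0 n) (eta1 n) (oV n) (VS n).
  by exists zn.
have /choice[y yP] : forall p : 'I_m * nat, exists y : C, [/\ X y, `|y| = 1,
    `|y + z p.2| <= 1 + 10 * eta p.2 /\ `|y - z p.2| <= 1 + 10 * eta p.2,
    forall t, `|(x p.1 - y) t| <= 4 * eta p.2 + 2 * (`|x p.1 t| * `|z p.2 t|) &
    forall t, `|x p.1 t| * `|z p.2 t| / 2 - 4 * eta p.2 <= `|(x p.1 - y) t|].
  move=> [i n] /=; have [Xz nz _ zS zV] := zP n.
  have [yn Xy [h1 h2 h3 h4]] := perturb_off_bump bS (eta0 n) (eta4 n)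
    (Xx i) (nx i) (sP i).1 (@Vs i n) (sP i).2 Xz zS zV.
  by exists yn.
have x1 i t : `|x i t| <= 1 by rewrite -(nx i); exact: supnorm_ub.
have z1 n t : `|z n t| <= 1.
  by have [_ <- _ _ _] := zP n; exact: supnorm_ub.
exists (fun i n => y (i, n)), z; split.
- split=> [i n|n]; first by have [] := yP (i, n).
  by have [] := zP n.
- move=> i.
  have off n t : S t -> ~ V n t -> `|(x i - y (i, n)) t| <= 6 * eta n.
    move=> St nVt; have [_ _ _ /(_ t)/= h _] := yP (i, n).
    have [_ _ _ _ /(_ t St nVt) zt] := zP n.
    have := ler_pM (normr_ge0 _) (normr_ge0 _) (x1 i t) zt; lra.
  (* The value x i t0 decides which alternative holds. *)
  have [xi0|xi0] := eqVneq (x i t0) 0; [left|right].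
    have small n : `|x i - y (i, n)| <= 6 * eta n.
      apply: boundary_norm_le bS _ _ _.
      - by apply: (uaB HA HX) => //; have [] := yP (i, n).
      - by have := eta0 n; lra.
      move=> t St; have [Vt|] := pselect (V n t); last exact: off.
      have [_ _ _ /(_ t)/= h _] := yP (i, n).
      have [] := VO n t Vt i; rewrite contfunD contfunN [contfun_cst _ _ _]xi0 subr0 => /ltW xt _.
      have := ler_pM (normr_ge0 _) (normr_ge0 _) xt (z1 n t); lra.
    apply/norm_cvg0P; apply: (@squeeze_cvgr _ _ _ _ (fun=> 0) (fun n => 6 * eta n)).
    + by apply: nearW => n; rewrite normr_ge0 small.
    + exact: cvg_cst.
    + by rewrite -(mulr0 6); apply: cvgM => //; exact: cvg_cst.
  apply: (@equiv_c0_basis_disjoint_bumps X S V _ (fun n => 6 * eta n)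
    (3 / 8 * kap) 3) => //.
  + move=> p l; apply: (ua_sum HA HX) => j.
    by apply: (uaB HA HX) => //; have [] := yP (i, j : nat).
  + by lra.
  + by move=> n; have := eta0 n; lra.
  + move=> p; rewrite -mulr_sumr sum_geometric_half.
    by have := eta0 p; rewrite /eta; lra.
  + move=> n; apply: supnorm_le => // t.
    have [_ _ _ /(_ t)/= h _] := yP (i, n).
    have := ler_pM (normr_ge0 _) (normr_ge0 _) (x1 i t) (z1 n t).
    have := eta4 n; lra.
  + move=> n; have [_ _ [p [Sp Vp] zp] _ _] := zP n; exists p => //.
    have [_ _ _ _ /(_ p)/=] := yP (i, n); rewrite zp mulr1.
    have [] := VO n p Vp i; rewrite contfunD contfunN => /ltW h _.
    have := kapP i xi0; have := lerB_dist (x i t0) (x i p); rewrite distrC.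
    rewrite [contfun_cst _ _ _]/= in h.
    have := eta_le n; lra.
- apply: (@equiv_c0_basis_disjoint_bumps X S V _ eta 1 1) => //.
  + by move=> p l; apply: (ua_sum HA HX) => j; have [] := zP j.
  + by move=> n; exact: ltW.
  + by move=> p; rewrite sum_geometric_half; have := eta0 p; rewrite /eta; lra.
  + by move=> n; have [_ ->] := zP n.
  + by move=> n; have [] := zP n.
  + by move=> n; have [_ _ [p ? zp] _ _] := zP n; exists p; rewrite ?zp.
- move=> i.
  (* Both norms are at most 1 + 10 eta n and their sum is at least that of 2 y,
     so neither is smaller than 1 - 10 eta n. *)
  have sum2 n : 2 <= `|y (i, n) + z n| + `|y (i, n) - z n|.
    apply: le_trans (ler_normD _ _); rewrite addrACA subrr addr0 -mulr2n normrMn.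
    by have [_ -> _ _ _] := yP (i, n).
  have lo : (fun n => 1 - 10 * eta n) @ \oo --> (1 : R).
    rewrite -[X in _ --> X]subr0 -(mulr0 10); apply: cvgB; first exact: cvg_cst.
    by apply: cvgM => //; exact: cvg_cst.
  have hi : (fun n => 1 + 10 * eta n) @ \oo --> (1 : R).
    rewrite -[X in _ --> X]addr0 -(mulr0 10); apply: cvgD; first exact: cvg_cst.
    by apply: cvgM => //; exact: cvg_cst.
  by split; apply: squeeze_cvgr lo hi; apply: nearW => n;
    have [_ _ /= [h1 h2] _ _] := yP (i, n); have s2 := sum2 n; apply/andP; split; lra.
Qed.

End sequential_SD2P.

End algebra.

(** * The real and the complex case *)

Lemma real_normed_division_algebra (R : realType) :
  normed_division_algebra (fun a b : R^o => a * b) 1.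
Proof.
split.
- by move=> a b c; rewrite mulrBr.
- by move=> l a b; rewrite /GRing.scale /= mulrA.
- exact: mul1r.
- exact: mulr1.
- exact: normrM.
- exact: normr1.
- by move=> a a0; exists a^-1; rewrite mulVf.
- exists 1%N, (fun=> 1) => a; exists (fun=> a).
  by rewrite big_ord1 /GRing.scale /= mulr1.
Qed.

Lemma complex_normed_division_algebra (R : realType) :
  normed_division_algebra (fun a b : Rcomplex R => a * b) 1.
Proof.
split.
- by move=> a b c; rewrite mulrBr.
- by move=> l a b; rewrite -scalerAl.
- exact: mul1r.
- exact: mulr1.
- exact: Normc.normcM.
- exact: Normc.normc1.
- by move=> a a0; exists a^-1; rewrite mulVf.
- exists 2%N, (fun k : 'I_2 => if k == ord0 then (1 +i* 0)%C else (0 +i* 1)%C) => -[a b].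
  exists (fun k : 'I_2 => if k == ord0 then a else b).
  rewrite big_ord_recl big_ord1 /=.
  by apply/eqP; rewrite eq_complex /= !mulr1 !mulr0 addr0 add0r !eqxx.
Qed.

Theorem mainTheorem6 (R : realType) (K : topologicalType)
    (hK : compact [set: K]) (hausK : hausdorff_space K) :
  (forall X : set (contfun hK R^o),
     real_uniform_algebra X -> infinite_dimensional X -> sequential_SD2P X) /\
  (forall X : set (contfun hK (Rcomplex R)),
     complex_uniform_algebra X -> infinite_dimensional X -> sequential_SD2P X).
Proof.
split=> X HX.
- exact: (@uniform_algebra_sequential_SD2P R K hK _ _ _
    (real_normed_division_algebra R) X HX hausK).
- exact: (@uniform_algebra_sequential_SD2P R K hK _ _ _
    (complex_normed_division_algebra R) X HX hausK).
Qed.
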